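(* Let $Z$ be a non-empty set, $F$ a correspondence from $Z$ to $Z$ with non-empty values, and $r$ a mapping from $Z$ to $[0,1]$. Assume that $Z$ is endowed with a distance $d$ such that: (a) $(Z,d)$ is a precompact metric space, and (b) the family of functions $(w_{m,n})_{m\geq 0,n\geq 1}$ is uniformly equicontinuous on $(Z,d)$. Then for every initial state $z$ in $Z$, the problem $\Gamma(z)=(Z,F,r,z)$ has a uniform value, which is $$v^*(z)=\underline{v}(z)=v^+(z)=v^-(z)=\sup_{m\geq 0}\inf_{n\geq 1}v_{m,n}(z)=\sup_{m\geq 0}\inf_{n\geq 1}w_{m,n}(z).$$ Moreover, the sequence of functions $(v_n)_{n\geq 1}$ converges uniformly on $Z$ to $v^*$.
   Context: A correspondence $F$ from $Z$ to $Z$ assigns to each $z\in Z$ a subset $F(z)\subseteq Z$. For $z_0\in Z$, a play at $z_0$ is a sequence $s=(z_1,z_2,\dots)\in Z^\infty$ with $z_t\in F(z_{t-1})$ for all $t\geq 1$; $S(z_0)$ is the set of plays at $z_0$. For a play $s=(z_t)_{t\geq 1}$, $m\geq 0$, $n\geq 1$: $\gamma_n(s)=\frac1n\sum_{t=1}^n r(z_t)$, $\gamma_{m,n}(s)=\frac1n\sum_{t=1}^n r(z_{m+t})$, $\nu_{m,n}(s)=\min\{\gamma_{m,t}(s): t\in\{1,\dots,n\}\}$. For $z\in Z$: $v_n(z)=\sup_{s\in S(z)}\gamma_n(s)$, $v_{m,n}(z)=\sup_{s\in S(z)}\gamma_{m,n}(s)$, $w_{m,n}(z)=\sup_{s\in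 S(z)}\nu_{m,n}(s)$; $v^-(z)=\liminf_n v_n(z)$, $v^+(z)=\limsup_n v_n(z)$, $\underline v(z)=\sup_{s\in S(z)}\left(\liminf_n\gamma_n(s)\right)$; and $v^*(z)=\inf_{n\geq1}\sup_{m\geq0}w_{m,n}(z)=\inf_{n\geq1}\sup_{m\geq0}v_{m,n}(z)$ (the two expressions are always equal). $\Gamma(z)$ has a uniform value if $\underline v(z)=v^+(z)$; the uniform value is then this common number. Precompact means totally bounded: for every $\varepsilon>0$ the space is covered by finitely many balls of radius $\varepsilon$. *)

(* Defs.v *)
From HB Require Import structures.
From mathcomp Require Import all_boot all_order all_algebra.
From mathcomp Require Import all_classical all_reals all_analysis.
Import Order.TTheory GRing.Theory Num.Theory.
Import numFieldNormedType.Exports.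

Set Implicit Arguments.
Unset Strict Implicit.
Unset Printing Implicit Defensive.

Local Open Scope classical_set_scope.
Local Open Scope ring_scope.

Section DynamicProgramming.
Context {R : realType} {Z : Type} (F : Z -> set Z) (r : Z -> R).
Implicit Types (s : nat -> Z) (z : Z) (m n : nat).

(* A play (z_1, z_2, ...) is encoded by s : nat -> Z with s t = z_(t+1). *)
Definition plays z : set (nat -> Z) :=
  [set s | F z (s 0%N) /\ forall t, F (s t) (s t.+1)].

(* All the quantities below are meant for n >= 1; their values at n = 0 are
   junk, which the infima over n avoid and which limits do not see. *)
Definition gamma n s : R := n%:R^-1 * \sum_(t < n) r (s t).

Definition gammam m n s : R := n%:R^-1 * \sum_(t < n) r (s (m + t)%N).

(* The default value gammam m 1 s is itself one of the terms when n >= 1. *)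
Definition nu m n s : R :=
  \big[Num.min/gammam m 1 s]_(1 <= t < n.+1) gammam m t s.

Definition v n z : R := sup [set gamma n s | s in plays z].

Definition vm m n z : R := sup [set gammam m n s | s in plays z].

Definition w m n z : R := sup [set nu m n s | s in plays z].

Definition vminus z : R := limn_inf (fun n => v n z).

Definition vplus z : R := limn_sup (fun n => v n z).

Definition vlow z : R := sup [set limn_inf (fun n => gamma n s) | s in plays z].

(* Replacing w by vm here gives the same number. *)
Definition vstar z : R :=
  inf [set sup (range (fun m => w m n z)) | n in [set n | (1 <= n)%N]].

Definition is_uniform_value z (x : R) : Prop := vlow z = x /\ vplus z = x.

Definition sup_inf_vm z : R :=
  sup (range (fun m => inf [set vm m n z | n in [set n | (1 <= n)%N]])).

Definition sup_inf_w z : R :=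
  sup (range (fun m => inf [set w m n z | n in [set n | (1 <= n)%N]])).

End DynamicProgramming.

(* Not the library's [precompact] (compact closure), which differs from total
   boundedness when Z is not complete. *)
Definition totally_bounded {R : realType} (Z : metricType R) : Prop :=
  forall e : R, 0 < e ->
    exists2 A : set Z, finite_set A & [set: Z] `<=` \bigcup_(x in A) ball x e.

Definition uniformly_equicontinuous {R : realType} {Z : metricType R} {I : Type}
    (W : set I) (f : I -> Z -> R) : Prop :=
  forall e : R, 0 < e -> exists2 d : R, 0 < d &
    forall x y : Z, mdist x y < d -> forall i, W i -> `|f i x - f i y| < e.

(* Main.v *)
Require Import Defs.
From HB Require Import structures.
From mathcomp Require Import all_boot all_order all_algebra.
From mathcomp Require Import all_classical all_reals all_analysis.
From mathcomp Require Import lra zify.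
Import Order.TTheory GRing.Theory Num.Theory.
Import numFieldNormedType.Exports.

Local Open Scope classical_set_scope.
Local Open Scope ring_scope.

(** Write [supw n z] for the supremum of [w m n z] over [m], so that [vstar z]
is the infimum of [supw n z] over [n >= 1]; it is the best level that some
stretch of a play can sustain over an arbitrarily long horizon.

Upper bound. If, from every position of a play, some average over at most [k]
stages is at most [a], the play can be cut greedily into blocks of length at
most [k] whose averages are at most [a], up to an incomplete last block. With
[a = supw k z] this bounds every [vm m n z] by [supw k z + k / n]
([vm_le_supw]). Nothing can therefore exceed [vstar] in the limit.

Compactness. Total boundedness and equicontinuity say that, up to [e], the
functions [w m n] see only finitely many kinds of states
([w_finitely_coloured]). This turns choices depending on a state or on a
horizon into uniform ones. In particular ([common_good_state]), if for each
horizon [n] a set contains a state from which the level [a] can be sustained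
for [n] stages, then one state of this set sustains [a - e] over all horizons.
Applied to the states reachable from [z], this gives a reachable state that
sustains [vstar z - e] over all horizons ([start_state]).

Lower bound. Say that [y] is safe for [b] if it sustains some level larger than
[b] over all horizons. From a safe state one follows a play that is good over a
very long horizon. The greedy cutting, used backwards, shows that it meets at a
positive time, while all its averages are still at least [b], a state that
again sustains a level above [b] for a given horizon; by compactness that state
can be chosen safe for [b] ([safe_segment]). The margin above [b] shrinks at
each repetition but remains positive, and the segments concatenate to an
infinite play all of whose averages are at least [b] ([safe_play]). With
[b = vstar z - e] this gives [vlow z >= vstar z]. Uniform convergence of [v n]
follows from the upper bound and [start_state], both made uniform in the state
by the colouring, and the limits inferior and superior of [v n z] are then its
limit [vstar z]. *)

(** * Averages of bounded sequences *)

Section RealSequences.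
Context {R : realType}.
Implicit Types (x u : nat -> R) (a c : R).

Lemma bounded_fun01 u : (forall n, 0 <= u n <= 1) -> bounded_fun (u : nat -> R^o).
Proof.
move=> u01; exists 1; split; first exact: num_real.
move=> c c1 n _ /=; have /andP[u0 u1] := u01 n.
by rewrite ger0_norm// (le_trans u1)// ltW.
Qed.

Lemma limn_inf_ge u a N : (forall n, 0 <= u n <= 1) ->
  (forall n, (N <= n)%N -> a <= u n) -> a <= limn_inf u.
Proof.
move=> u01 ua; rewrite limn_infE; last exact: bounded_fun01.
apply: (@le_trans _ _ (infs u N)).
  apply: lb_le_inf; first by exists (u N), N => /=.
  by move=> _ [n /= Nn <-]; exact: ua.
apply: ub_le_sup; last by exists N.
exact/bounded_fun_has_ubound_infs/bounded_fun01.
Qed.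

Lemma limn_inf_le u a : (forall n, 0 <= u n <= 1) ->
  (forall N, exists2 n, (N <= n)%N & u n <= a) -> limn_inf u <= a.
Proof.
move=> u01 ua; rewrite limn_infE; last exact: bounded_fun01.
apply: ge_sup; first by exists (infs u 0%N), 0%N.
move=> _ [N _ <-]; have [n Nn una] := ua N.
apply: le_trans una; apply: ge_inf; last by exists n.
by exists 0 => _ [k _ <-]; have /andP[] := u01 k.
Qed.

Lemma sum01_bounds x p n : (forall t, 0 <= x t <= 1) ->
  0 <= \sum_(i < n) x (p + i)%N <= n%:R.
Proof.
move=> x01; rewrite sumr_ge0 /=; last by move=> i _; have /andP[] := x01 (p + i)%N.
rewrite -[leRHS]mulr1 -[n in leRHS]card_ord mulr_natl -sumr_const ler_sum// => i _.
by have /andP[] := x01 (p + i)%N.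
Qed.

Lemma sum_split x p m n :
  \sum_(i < m + n) x (p + i)%N =
  \sum_(i < m) x (p + i)%N + \sum_(i < n) x (p + m + i)%N.
Proof.
by rewrite big_split_ord /=; congr (_ + _); apply: eq_bigr => i _; rewrite addnA.
Qed.

(** Greedy cutting: starting at [p], repeatedly remove a block of at most [k]
terms with average at most [a], until at most [k] terms are left; these
contribute at most [k]. *)
Lemma sum_le_of_blocks x a k : (forall t, 0 <= x t <= 1) ->
  forall n p, (forall q, (p <= q < p + n)%N ->
    exists2 t, (0 < t <= k)%N & \sum_(i < t) x (q + i)%N <= a * t%:R) ->
  \sum_(i < n) x (p + i)%N <= a * n%:R + k%:R.
Proof.
move=> x01 n; have [N] := ubnP n; elim: N n => // N IH [|n] nN p blocks.
  by rewrite big_ord0 mulr0 add0r.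
have [|t /andP[t0 tk] xt] := blocks p; first by lia.
(* The block starting at [p] is nonnegative, hence so is its bound. *)
have a0 : 0 <= a.
  have /andP[sum0 _] := sum01_bounds x p t x01.
  by move: (le_trans sum0 xt); rewrite pmulr_lge0 ?ltr0n.
have [nk|kn] := leqP n.+1 k.
  have /andP[_ /le_trans->//] := sum01_bounds x p n.+1 x01.
  by rewrite ler_wpDl ?mulr_ge0// ler_nat.
have -> : n.+1 = (t + (n.+1 - t))%N by lia.
rewrite sum_split natrD mulrDr -addrA lerD//; apply: IH; first by lia.
by move=> q q_range; apply: blocks; lia.
Qed.

Lemma archimedean_gt a e : 0 < e -> exists n, a < e * n%:R.
Proof.
move=> e0; exists (Num.bound `|a / e|).
by rewrite mulrC -ltr_pdivrMr//;
  apply: le_lt_trans (ler_norm _) (archi_boundP (normr_ge0 _)).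
Qed.

End RealSequences.

(** * Extrema of families with values in the unit interval *)

Section BoundedExtrema.
Context {R : realType} {T : Type}.
Implicit Types (f : T -> R) (A : set T).

Lemma img_le_sup f A t : (forall x, f x <= 1) -> A t ->
  f t <= sup [set f x | x in A].
Proof.
move=> f1 At; apply: ub_le_sup; last by exists t.
by exists 1 => _ [x _ <-].
Qed.

Lemma sup_img_le f A c : A !=set0 -> (forall x, A x -> f x <= c) ->
  sup [set f x | x in A] <= c.
Proof.
move=> [t At] fc; apply: ge_sup; first by exists (f t), t.
by move=> _ [x Ax <-]; exact: fc.
Qed.

Lemma sup_img_approx f A e : (forall x, f x <= 1) -> A !=set0 -> 0 < e ->
  exists2 x, A x & sup [set f x | x in A] - e < f x.
Proof.
move=> f1 [t At] e0; have [|_ [x Ax <-] fx] := sup_adherent e0 (E := f @` A).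
  by split; [exists (f t), t|exists 1 => _ [x _ <-]].
by exists x.
Qed.

Lemma inf_img_le f A t : (forall x, 0 <= f x) -> A t ->
  inf [set f x | x in A] <= f t.
Proof.
move=> f0 At; apply: ge_inf; last by exists t.
by exists 0 => _ [x _ <-].
Qed.

Lemma le_inf_img f A c : A !=set0 -> (forall x, A x -> c <= f x) ->
  c <= inf [set f x | x in A].
Proof.
move=> [t At] fc; apply: lb_le_inf; first by exists (f t), t.
by move=> _ [x Ax <-]; exact: fc.
Qed.

Lemma inf_img_approx f A e : (forall x, 0 <= f x) -> A !=set0 -> 0 < e ->
  exists2 x, A x & f x < inf [set f x | x in A] + e.
Proof.
move=> f1 [t At] e0; have [|_ [x Ax <-] fx] := inf_adherent e0 (E := f @` A).
  by split; [exists (f t), t|exists 0 => _ [x _ <-]].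
by exists x.
Qed.

(** A choice of [n] for each [y] in [A] becomes bounded if [y] may be replaced by
a point of [A] of the same colour: one representative per colour suffices. *)
Lemma finite_uniform_bound k (c : T -> 'I_k) A (P : T -> nat -> Prop) :
  (forall y, A y -> exists n, P y n) ->
  exists N, forall y, A y ->
    exists x n, [/\ A x, c x = c y, (n <= N)%N & P x n].
Proof.
move=> AP; have /choice[g gP] : forall i : 'I_k, exists n,
    forall y, A y -> c y = i -> exists2 x, A x & c x = i /\ P x n.
  move=> i; have [[y [Ay cy]]|noy] := pselect (exists y, A y /\ c y = i).
    by have [n Pn] := AP _ Ay; exists n => _ _ _; exists y.
  by exists 0%N => y Ay cy; exfalso; apply: noy; exists y.
exists (\max_i g i) => y Ay; have [x Ax [cx Px]] := gP _ _ Ay erefl.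
by exists x, (g (c y)); split=> //; exact: leq_bigmax.
Qed.

End BoundedExtrema.

(** * Plays and their concatenation *)

Section Plays.
Context {R : realType} {Z : Type} (F : Z -> set Z) (r : Z -> R).
Hypotheses (F_neq0 : forall z, F z !=set0) (r01 : forall z, 0 <= r z <= 1).
Implicit Types (s : nat -> Z) (z : Z) (m n k : nat) (a b e : R).

(** The state at stage [m], counting the initial state as stage 0; since [s t] is
the state at stage [t + 1], the value of [s] is read at [m - 1]. *)
Definition state z s m : Z := if m is m'.+1 then s m' else z.

Definition splice s m s' : nat -> Z :=
  fun t => if (t < m)%N then s t else s' (t - m)%N.

(** With [state], the separate clause for the first move disappears. *)
Lemma plays_state z s : plays F z s <-> forall t, F (state z s t) (s t).
Proof.
by split=> [[s0 sS] [//|t]|sF]; [exact: sS|split=> [|t];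
  [exact: (sF 0%N)|exact: (sF t.+1)]].
Qed.

Lemma plays_neq0 z : plays F z !=set0.
Proof.
have /choice[f fF] : forall y, exists x, F y x.
  by move=> y; have [x] := F_neq0 y; exists x.
by exists (fun t => iter t.+1 f z); apply/plays_state => -[|t]; exact: fF.
Qed.

Lemma state_shift z s m n :
  state (state z s m) (fun t => s (m + t)%N) n = state z s (m + n).
Proof. by case: n => [|n]; rewrite ?addn0 ?addnS. Qed.

Lemma plays_shift z s m : plays F z s ->
  plays F (state z s m) (fun t => s (m + t)%N).
Proof. by move=> /plays_state sF; apply/plays_state => t; rewrite state_shift. Qed.

Lemma spliceD s m s' t : splice s m s' (m + t) = s' t.
Proof. by rewrite /splice ltnNge leq_addr /= addKn. Qed.

Lemma plays_splice z s m s' : plays F z s -> plays F (state z s m) s' ->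
  plays F z (splice s m s').
Proof.
move=> /plays_state sF /plays_state s'F; apply/plays_state => t.
have [tm|mt] := ltnP t m.
  rewrite {2}/splice tm; suff -> : state z (splice s m s') t = state z s t by [].
  by case: t tm => //= t tm; rewrite /splice ltnW.
rewrite -(subnKC mt) spliceD; move: (t - m)%N => {mt}n.
suff -> : state z (splice s m s') (m + n) = state (state z s m) s' n by [].
case: n => [|n]; last by rewrite addnS /= spliceD.
by rewrite addn0; case: m {s'F} => //= m; rewrite /splice ltnSn.
Qed.

(** * Elementary properties of the values *)

Lemma rplay01 s t : 0 <= r (s t) <= 1. Proof. exact: r01. Qed.

Lemma gammam01 m n s : 0 <= gammam r m n s <= 1.
Proof.
have /andP[s0 sn] := sum01_bounds _ m n (rplay01 s).
rewrite /gammam; case: n s0 sn => [|n] s0 sn; first by rewrite invr0 mul0r lexx ler01.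
by rewrite mulr_ge0//= ler_pdivrMl ?ltr0n// mulr1.
Qed.

Lemma gammam_geE m n s a : (0 < n)%N ->
  (a <= gammam r m n s) = (a * n%:R <= \sum_(t < n) r (s (m + t)%N)).
Proof. by move=> n0; rewrite /gammam ler_pdivlMl ?ltr0n// mulrC. Qed.

Lemma gammam_leE m n s a : (0 < n)%N ->
  (gammam r m n s <= a) = (\sum_(t < n) r (s (m + t)%N) <= a * n%:R).
Proof. by move=> n0; rewrite /gammam ler_pdivrMl ?ltr0n// mulrC. Qed.

Lemma nu_le_gammam m n s t : (0 < t <= n)%N -> nu r m n s <= gammam r m t s.
Proof. by move=> tn; apply: (bigmin_inf_seq _ t) => //; rewrite mem_index_iota ltnS. Qed.

Lemma nu_attained m n s : (0 < n)%N ->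
  exists2 t, (0 < t <= n)%N & gammam r m t s = nu r m n s.
Proof.
move=> n0; pose P a := exists2 t, (0 < t <= n)%N & gammam r m t s = a.
rewrite /nu big_seq; apply: (big_ind P); first by exists 1%N.
  by move=> a b Pa Pb; rewrite /Num.min; case: ifP.
by move=> t; rewrite mem_index_iota ltnS; exists t.
Qed.

Lemma nu01 m n s : 0 <= nu r m n s <= 1.
Proof.
apply/andP; split.
  by apply: le_bigmin => [|t _]; [have /andP[] := gammam01 m 1 s|
    have /andP[] := gammam01 m t s].
by apply: le_trans (bigmin_le_id _ _ _ _) _; have /andP[] := gammam01 m 1 s.
Qed.

Lemma nu_le1 m n s : nu r m n s <= 1. Proof. by have /andP[] := nu01 m n s. Qed.

Lemma nu_shift m n p s : nu r (m + p) n s = nu r p n (fun t => s (m + t)%N).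
Proof.
have E t : gammam r (m + p) t s = gammam r p t (fun t => s (m + t)%N).
  by rewrite /gammam; under eq_bigr do rewrite -addnA.
by rewrite /nu E; apply: eq_bigr => t _; exact: E.
Qed.

Lemma nu_le_w m n s z : plays F z s -> nu r m n s <= w F r m n z.
Proof. by move=> sz; apply: (img_le_sup (nu r m n)) => // ?; exact: nu_le1. Qed.

Lemma w_approx m n z e : 0 < e ->
  exists2 s, plays F z s & w F r m n z - e < nu r m n s.
Proof. by apply: sup_img_approx; [exact: nu_le1|exact: plays_neq0]. Qed.

Lemma w_le m n z a : (forall s, plays F z s -> nu r m n s <= a) -> w F r m n z <= a.
Proof. by apply: sup_img_le; exact: plays_neq0. Qed.

Lemma w01 m n z : 0 <= w F r m n z <= 1.
Proof.
have [s sz] := plays_neq0 z.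
rewrite (le_trans _ (nu_le_w m n s z sz)) /=; last by have /andP[] := nu01 m n s.
by apply: w_le => s' _; exact: nu_le1.
Qed.

Lemma w_le1 m n z : w F r m n z <= 1. Proof. by have /andP[] := w01 m n z. Qed.

Lemma w_ge0 m n z : 0 <= w F r m n z. Proof. by have /andP[] := w01 m n z. Qed.

Lemma w_antitone m k n z : (0 < k <= n)%N -> w F r m n z <= w F r m k z.
Proof.
move=> /andP[k0 kn]; apply: w_le => s sz; apply: le_trans (nu_le_w _ _ _ _ sz).
have [t tk <-] := nu_attained m k s k0; apply: nu_le_gammam; lia.
Qed.

(** Together with [w_state_le], this says that [w m n z] is the supremum of
[w 0 n y] over the states [y] reachable from [z] in [m] stages: the minimum
[nu m n s] depends only on the play after stage [m]. *)
Lemma nu_le_w_state m n s z : plays F z s -> nu r m n s <= w F r 0 n (state z s m).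
Proof. by move=> sz; rewrite -[m in leLHS]addn0 nu_shift; exact/nu_le_w/plays_shift. Qed.

Lemma w_state_le m n s z : plays F z s -> w F r 0 n (state z s m) <= w F r m n z.
Proof.
move=> sz; apply: w_le => s' s'z.
apply: le_trans (nu_le_w _ _ _ _ (plays_splice _ _ _ _ sz s'z)).
suff -> : nu r m n (splice s m s') = nu r 0 n s' by [].
rewrite -[X in nu r X]addn0 nu_shift; congr nu.
by apply/funext => t; rewrite spliceD.
Qed.

Definition supw n z : R := sup (range (fun m => w F r m n z)).

Lemma w_le_supw m n z : w F r m n z <= supw n z.
Proof. by apply: (img_le_sup (fun m => w F r m n z)) => // ?; exact: w_le1. Qed.

Lemma supw_ge0 n z : 0 <= supw n z.
Proof. exact: le_trans (w_ge0 0 n z) (w_le_supw 0 n z). Qed.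

Lemma supw_le n z a : (forall m, w F r m n z <= a) -> supw n z <= a.
Proof. by move=> wa; apply: sup_img_le => //; exists 0%N. Qed.

Lemma vstar_le_supw n z : (0 < n)%N -> vstar F r z <= supw n z.
Proof. by move=> n0; apply: (inf_img_le (supw^~ z)) => // k; exact: supw_ge0. Qed.

Lemma vstar_approx z e : 0 < e ->
  exists2 n, (0 < n)%N & supw n z < vstar F r z + e.
Proof.
by apply: (inf_img_approx (supw^~ z)) => [k|]; [exact: supw_ge0|exists 1%N].
Qed.

Lemma le_vstar z a : (forall n, (0 < n)%N -> a <= supw n z) -> a <= vstar F r z.
Proof. by apply: (le_inf_img (supw^~ z)); exists 1%N. Qed.

Lemma vstar_le1 z : vstar F r z <= 1.
Proof.
by apply: le_trans (vstar_le_supw 1 z _) _ => //; apply: supw_le => m; exact: w_le1.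
Qed.

Lemma gammam_le_vm m n s z : plays F z s -> gammam r m n s <= vm F r m n z.
Proof.
by move=> sz; apply: (img_le_sup (gammam r m n)) => // x; have /andP[] := gammam01 m n x.
Qed.

Lemma vm_le m n z a : (forall s, plays F z s -> gammam r m n s <= a) ->
  vm F r m n z <= a.
Proof. by apply: sup_img_le; exact: plays_neq0. Qed.

Lemma v_vm n z : v F r n z = vm F r 0 n z. Proof. by []. Qed.

Lemma vm01 m n z : 0 <= vm F r m n z <= 1.
Proof.
have [s sz] := plays_neq0 z.
rewrite (le_trans _ (gammam_le_vm m n s z sz)) /=; last by have /andP[] := gammam01 m n s.
by apply: vm_le => s' _; have /andP[] := gammam01 m n s'.
Qed.

Lemma w_le_vm m n z : (0 < n)%N -> w F r m n z <= vm F r m n z.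
Proof.
move=> n0; apply: w_le => s sz; apply: le_trans (gammam_le_vm _ _ _ _ sz).
by apply: nu_le_gammam; rewrite n0 leqnn.
Qed.

(** At every position [q] of a play from [z], [nu q k] is at most [supw k z], so
some average over at most [k] stages is too, and the play can be cut into
blocks. *)
Lemma vm_le_supw m n k z : (0 < n)%N -> (0 < k)%N ->
  vm F r m n z <= supw k z + k%:R / n%:R.
Proof.
move=> n0 k0; apply: vm_le => s sz.
rewrite gammam_leE// mulrDl divfK ?pnatr_eq0 -?lt0n//.
apply: (sum_le_of_blocks (r \o s)) => [t|q _]; first exact: r01.
have [t tk tnu] := nu_attained q k s k0; exists t => //.
have /andP[t0 _] := tk; rewrite -gammam_leE// tnu.
exact: le_trans (nu_le_w _ _ _ _ sz) (w_le_supw _ _ _).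
Qed.

(** Starting the average [m] stages earlier changes the sum of rewards by at most
[m]. *)
Lemma vm_le_v m n z : (0 < n)%N -> vm F r m n z <= v F r n z + m%:R / n%:R.
Proof.
move=> n0; apply: vm_le => s sz.
have /le_trans -> // : gammam r m n s <= gammam r 0 n s + m%:R / n%:R.
  rewrite /gammam [_ / _]mulrC -mulrDr ler_wpM2l ?invr_ge0//.
  have /andP[sm _] := sum01_bounds (r \o s) 0 m (rplay01 s).
  have /andP[_ snm] := sum01_bounds (r \o s) (0 + n) m (rplay01 s).
  have := sum_split (r \o s) 0 m n; rewrite addnC (sum_split (r \o s)) /=.
  by move: sm snm => /=; lra.
by rewrite lerD2r; exact: (gammam_le_vm 0).
Qed.

(** * Uniformity from total boundedness *)

(** The family of all [w m n] with [n >= 1] does not distinguish, up to [e],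
states of the same colour. Equivalently, [Z] is totally bounded for the
pseudodistance given by the supremum of the differences of the [w m n]. The
one-sided inequality is enough since [x] and [y] can be exchanged. *)
Definition w_finitely_coloured : Prop := forall e, 0 < e ->
  exists k (c : Z -> 'I_k), forall x y, c x = c y ->
    forall m n, (0 < n)%N -> w F r m n x <= w F r m n y + e.

Lemma colour_supw e x y : (forall m n, (0 < n)%N -> w F r m n x <= w F r m n y + e) ->
  forall n, (0 < n)%N -> supw n x <= supw n y + e.
Proof.
move=> wxy n n0; apply: supw_le => m; apply: le_trans (wxy m n n0) _.
by rewrite lerD2r; exact: w_le_supw.
Qed.

Lemma colour_vstar e x y : (forall m n, (0 < n)%N -> w F r m n x <= w F r m n y + e) ->
  vstar F r x <= vstar F r y + e.
Proof.
move=> wxy; rewrite -lerBlDr; apply: le_vstar => n n0; rewrite lerBlDr.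
exact: le_trans (vstar_le_supw n x n0) (colour_supw _ _ _ wxy n n0).
Qed.

(** Otherwise every state of [A] fails at some horizon. Up to colour, these
horizons are bounded by some [N], whereas the state of [A] that is good for the
horizon [N + 1] has the colour of one that fails at a horizon
at most [N]. *)
Lemma common_good_state (A : set Z) a e : w_finitely_coloured -> 0 < e ->
  (forall n, (0 < n)%N -> exists2 y, A y & a <= w F r 0 n y) ->
  exists2 y, A y & forall n, (0 < n)%N -> a - e <= w F r 0 n y.
Proof.
move=> wc e0 An; have [k [c cP]] := wc _ e0.
have [//|no_good] :=
  pselect (exists2 y, A y & forall n, (0 < n)%N -> a - e <= w F r 0 n y).
have [|N NP] := finite_uniform_bound k c A
    (fun y n => (0 < n)%N /\ w F r 0 n y < a - e).
  move=> y Ay; have [//|no_n] := pselect (exists n, (0 < n)%N /\ w F r 0 n y < a - e).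
  exfalso; apply: no_good; exists y => // n n0; rewrite leNgt; apply/negP => wn.
  by apply: no_n; exists n.
have [y Ay ay] := An N.+1 isT.
have [x [n [Ax cx nN [n0 wn]]]] := NP _ Ay.
have := cP _ _ (esym cx) 0%N N.+1 isT.
have : w F r 0 N.+1 x <= w F r 0 n x by apply: w_antitone; rewrite n0 ltnW.
lra.
Qed.

(** For each [n] the supremum [supw n z] is at least [vstar z], so states
reachable from [z] come close to this level for the horizon [n];
[common_good_state] makes one of them work for all [n]. *)
Lemma start_state z e : w_finitely_coloured -> 0 < e ->
  exists s m, plays F z s /\
    forall n, (0 < n)%N -> vstar F r z - e <= w F r 0 n (state z s m).
Proof.
move=> wc e0; have e20 : 0 < e / 2 by rewrite divr_gt0.
have [|_ [s [m [sz ->]]] good] := common_good_state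
    [set y | exists s m, plays F z s /\ y = state z s m]
    (vstar F r z - e / 2) (e / 2) wc e20.
  move=> n n0; have e40 : 0 < e / 4 by rewrite divr_gt0.
  have [m _] := sup_img_approx (fun m => w F r m n z) setT (e / 4)
    (fun m => w_le1 m n z) (ex_intro _ 0%N I) e40.
  rewrite -/(supw n z) => wm.
  have [s sz ws] := w_approx m n z _ e40.
  exists (state z s m); first by exists s, m.
  apply: le_trans (nu_le_w_state m n s z sz).
  by have := vstar_le_supw n z n0; lra.
exists s, m; split=> // n n0; apply: le_trans (good n n0); lra.
Qed.

(** * A play whose averages stay above a safe level *)

Definition safe b y := exists2 d, 0 < d & forall n, (0 < n)%N -> b + d <= w F r 0 n y.

(** The greedy cutting read backwards: a play that keeps its averages above
[b + d] for very long cannot have at all positive times a short block with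
average below [b]. The bound [N] is independent of the play, and the position
is positive, so that following the play up to it is actual progress. *)
Lemma good_position b d k : 0 < d -> (0 < k)%N ->
  exists N, forall s, (forall t, (0 < t <= N.+1)%N -> b + d <= gammam r 0 t s) ->
  exists2 p, (0 < p <= N)%N & b <= nu r p k s.
Proof.
move=> d0 k0.
(* Cutting from position 1 would bound the sum of the first [N + 1] rewards by
   [1 + b * N + k], which this choice of [N] makes less than
   [(b + d) * (N + 1)]. *)
have [N NP] := archimedean_gt (1 + k%:R - (b + d)) d d0.
exists N => s sN.
have [//|no_p] := pselect (exists2 p, (0 < p <= N)%N & b <= nu r p k s).
exfalso.
have := sum_le_of_blocks (r \o s) b k (rplay01 s) N 1%N.
have /[swap]/[apply] : forall q, (1 <= q < 1 + N)%N -> exists2 t, (0 < t <= k)%N &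
    \sum_(i < t) (r \o s) (q + i)%N <= b * t%:R.
  move=> q qN; have [t tk tnu] := nu_attained q k s k0; exists t => //.
  have /andP[t0 _] := tk; rewrite -gammam_leE// tnu leNgt.
  by apply/negP => /ltW bq; apply: no_p; exists q => //; lia.
have := sN N.+1; rewrite ltnSn /= => /(_ isT); rewrite gammam_geE//.
have := sum_split (r \o s) 0 1 N; rewrite !add0n add1n /= => ->.
rewrite big_ord1 -[N.+1]addn1 natrD mulrDr mulr1.
by have /andP[_] := r01 (s (0 + 0)%N); move: NP; rewrite mulrDl; lra.
Qed.

(** A margin [d] above [b] is spent in quarters: one on approximating [w], one on
the cutting argument of [good_position], one on making the final state good for
all horizons. The last one is the margin at the end of the segment. *)
Lemma safe_segment b y : w_finitely_coloured -> safe b y ->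
  exists s p, [/\ plays F y s, (0 < p)%N, safe b (state y s p) &
    forall t, (t <= p)%N -> b * t%:R <= \sum_(i < t) r (s i)].
Proof.
move=> wc [d d0 yd]; have d40 : 0 < d / 4 by rewrite divr_gt0.
pose A := [set x | exists s p, [/\ plays F y s, (0 < p)%N, x = state y s p &
    forall t, (t <= p)%N -> b * t%:R <= \sum_(i < t) r (s i)]].
have [|_ [s [p [sy p0 -> sp]]] good] := common_good_state A (b + d / 2) (d / 4) wc d40.
  move=> k k0.
  have [N NP] := good_position (b + d / 2) (d / 4) k d40 k0.
  have [s sy sw] := w_approx 0 N.+1 y (d / 4) d40.
  have sN t : (0 < t <= N.+1)%N -> b + d / 2 + d / 4 <= gammam r 0 t s.
    by move=> /(nu_le_gammam 0 N.+1 s); have := yd N.+1 isT; lra.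
  have [p /andP[p0 pN] bp] := NP s sN; exists (state y s p).
    exists s, p; split=> // -[|t] tp; first by rewrite big_ord0 mulr0.
    by rewrite -(gammam_geE 0)//; have := sN t.+1 ltac:(lia); lra.
  exact: le_trans bp (nu_le_w_state _ _ _ _ sy).
exists s, p; split=> //; exists (d / 4) => // n n0.
by apply: le_trans (good n n0); lra.
Qed.

(** Concatenating segments with averages at least [b] keeps all averages at least
[b]. To obtain the infinite play by one-step choices, the construction carries
the pair [q] of the current state and of the surplus, the sum of the terms
[r - b] collected so far; [onway q] says that the rest of the current segment
leads to a safe state without making the surplus negative. *)
Lemma safe_play b y : w_finitely_coloured -> safe b y ->
  exists2 s, plays F y s & forall n, b * n%:R <= \sum_(i < n) r (s i).
Proof.
move=> wc safe_y.
pose onway (q : Z * R) := exists s p, [/\ plays F q.1 s, safe b (state q.1 s p) &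
  forall t, (t <= p)%N -> b * t%:R <= q.2 + \sum_(i < t) r (s i)].
have /choice[g gP] : forall q, exists q',
    onway q -> [/\ F q.1 q'.1, q'.2 = q.2 + r q'.1 - b & onway q'].
  move=> [x a]; have [way|no_way] := pselect (onway (x, a)); last first.
    by exists (x, a) => /no_way.
  have [s [p [/plays_state sx p0 sp sums]]] : exists s p, [/\ plays F x s, (0 < p)%N,
      safe b (state x s p) &
      forall t, (t <= p)%N -> b * t%:R <= a + \sum_(i < t) r (s i)].
    (* When the current segment is exhausted, a new one starts. *)
    have [s [[|p] [/= sx sp sums]]] := way; last by exists s, p.+1.
    have a0 : 0 <= a by have := sums 0%N isT; rewrite big_ord0 mulr0 addr0.
    have [s' [p' [s'x p'0 s'p sums']]] := safe_segment b x wc sp.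
    by exists s', p'; split=> // t tp'; rewrite ler_wpDl// sums'.
  exists (s 0%N, a + r (s 0%N) - b) => _; split=> //=; first exact: (sx 0%N).
  exists (fun t => s (1 + t)%N), p.-1; split=> /=.
  - exact/(plays_shift x s 1)/plays_state.
  - by case: p p0 sp {sums} => // -[|p].
  - move=> t tp; have := sums t.+1; rewrite big_ord_recl /= -natr1 mulrDr mulr1.
    have -> : (t < p)%N by lia.
    by move=> /(_ isT); rewrite /bump /=; lra.
pose q n := iter n g (y, 0).
have way n : onway (q n).
  elim: n => [|n IH]; last by have [] := gP _ IH.
  have [s sy] := plays_neq0 y; exists s, 0%N; split=> // t.
  by rewrite leqn0 => /eqP ->; rewrite big_ord0 mulr0 addr0.
exists (fun t => (q t.+1).1).
  by apply/plays_state => t; have [+ _ _] := gP _ (way t); case: t.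
have surplus n : (q n).2 = \sum_(i < n) r (q i.+1).1 - b * n%:R.
  elim: n => [|n IH]; first by rewrite big_ord0 mulr0 subr0.
  rewrite big_ord_recr /= -natr1 mulrDr mulr1.
  by have [_ -> _] := gP _ (way n); rewrite IH; lra.
move=> n; rewrite -subr_ge0 -surplus; have [s [p [_ _ /(_ 0%N isT)]]] := way n.
by rewrite big_ord0 mulr0 addr0.
Qed.

(** Reach the state of [start_state] and continue with [safe_play]; the finitely
many stages before it do not matter for the limit inferior. *)
Lemma long_run_play z e : w_finitely_coloured -> 0 < e ->
  exists2 s, plays F z s & vstar F r z - e <= limn_inf (fun n => gamma r n s).
Proof.
move=> wc e0; have e40 : 0 < e / 4 by rewrite divr_gt0.
have [s [m [sz good]]] := start_state z (e / 4) wc e40.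
have [|s' s'z sums] := safe_play (vstar F r z - e / 2) (state z s m) wc.
  by exists (e / 4) => // n n0; apply: le_trans (good n n0); lra.
exists (splice s m s'); first exact: plays_splice.
(* The [m] initial stages cost at most [m], which the margin [e / 2] per stage
   outweighs after [M] more stages. *)
have [M MP] := archimedean_gt m%:R (e / 2) ltac:(lra).
apply: (limn_inf_ge _ _ (M + m).+1) => [n|n Mn]; first exact: (gammam01 0).
rewrite (gammam_geE 0)//; last by lia.
have -> : n = (m + (n - m))%N by lia.
set l := (n - m)%N; rewrite (sum_split (r \o splice s m s') 0 m) /=.
have -> : \sum_(i < l) r (splice s m s' (0 + m + i)) = \sum_(i < l) r (s' i).
  by apply: eq_bigr => i _; rewrite add0n spliceD.
have /andP[sm _] := sum01_bounds (r \o splice s m s') 0 m (rplay01 _).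
have := sums l; have := vstar_le1 z.
move=> V1 sumV; rewrite natrD mulrDr.
have : (vstar F r z - e) * m%:R <= m%:R by rewrite ler_piMl//; lra.
have : e / 2 * M%:R <= e / 2 * l%:R by rewrite ler_pM2l ?divr_gt0// ler_nat /l; lia.
by move: sm sumV MP => /=; lra.
Qed.

(** * Convergence of the values *)

(** Above, [vm_le_supw] with a horizon [k] such that [supw k] is close to [vstar];
below, [w_le_vm] and [vm_le_v] with a delay [m] such that [w m n] is close to
[vstar] for all [n]. The colouring bounds [k] by [K] and [m] by [M],
independently of the state. *)
Lemma v_uniform_cvg e : w_finitely_coloured -> 0 < e ->
  exists N, forall n z, (N <= n)%N -> `|v F r n z - vstar F r z| <= e.
Proof.
move=> wc e0; have e40 : 0 < e / 4 by rewrite divr_gt0.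
have [k [c cP]] := wc _ e40.
have [|K KP] := finite_uniform_bound k c setT
    (fun x n => (0 < n)%N /\ supw n x <= vstar F r x + e / 4).
  by move=> x _; have [n n0 /ltW wn] := vstar_approx x _ e40; exists n.
have [|M MP] := finite_uniform_bound k c setT
    (fun x m => forall n, (0 < n)%N -> vstar F r x - e / 4 <= w F r m n x).
  move=> x _; have [s [m [sx good]]] := start_state x (e / 4) wc e40; exists m => n n0.
  exact: le_trans (good n n0) (w_state_le _ _ _ _ sx).
have [N NP] := archimedean_gt (K + M)%:R (e / 4) e40.
exists N.+1 => n z Nn; have n0 : (0 < n)%N by lia.
have ratio l : (l <= K + M)%N -> l%:R / n%:R <= e / 4.
  move=> lKM; rewrite ler_pdivrMr ?ltr0n//; apply: le_trans (_ : e / 4 * N%:R <= _).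
    by apply: le_trans (ltW NP); rewrite ler_nat.
  by rewrite ler_pM2l// ler_nat ltnW.
rewrite ler_distl; apply/andP; split.
  have [x [m [_ cx mM good]]] := MP z I.
  have := cP _ _ cx m n n0; have := good n n0; have := ratio m ltac:(lia).
  have := colour_vstar _ _ _ (cP _ _ (esym cx)).
  have := le_trans (w_le_vm m n z n0) (vm_le_v m n z n0).
  lra.
have [x [l [_ cx lK [l0 good]]]] := KP z I.
have := colour_supw _ _ _ (cP _ _ (esym cx)) l l0.
have := colour_vstar _ _ _ (cP _ _ cx); have := ratio l ltac:(lia).
have := vm_le_supw 0 n l z n0 l0; rewrite -v_vm; lra.
Qed.

Lemma v_cvg z : w_finitely_coloured -> v F r n z @[n --> \oo] --> vstar F r z.
Proof.
move=> wc; apply/cvgrPdist_le => e e0; have [N NP] := v_uniform_cvg e wc e0.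
by exists N => // n Nn; rewrite distrC; exact: NP.
Qed.

Lemma gamma01 n s : 0 <= gamma r n s <= 1. Proof. exact: (gammam01 0). Qed.

Lemma limn_inf_gamma_le z s : w_finitely_coloured -> plays F z s ->
  limn_inf (fun n => gamma r n s) <= vstar F r z.
Proof.
move=> wc sz; apply/ler_addgt0Pr => e e0; have [N NP] := v_uniform_cvg e wc e0.
apply: limn_inf_le => [n|M]; first exact: gamma01.
exists (M + N)%N; first exact: leq_addr.
have := NP (M + N)%N z (leq_addl _ _); rewrite ler_distl => /andP[_].
exact: le_trans (gammam_le_vm 0 _ _ _ sz).
Qed.

Lemma vlow_vstar z : w_finitely_coloured -> vlow F r z = vstar F r z.
Proof.
move=> wc; apply/le_anti/andP; split.
  by apply: sup_img_le => [|s]; [exact: plays_neq0|exact: limn_inf_gamma_le].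
apply/ler_addgt0Pr => e e0; have [s sz vs] := long_run_play z e wc e0.
rewrite -lerBlDr; apply: le_trans vs _; apply: ub_le_sup; last by exists s.
by exists (vstar F r z) => _ [s' s'z <-]; exact: limn_inf_gamma_le.
Qed.

(** Let [n] go to infinity in [vm_le_supw], then take the infimum over [k]. *)
Lemma inf_vm_le_vstar m z :
  inf [set vm F r m n z | n in [set n | (1 <= n)%N]] <= vstar F r z.
Proof.
apply: le_vstar => k k0; apply/ler_addgt0Pr => e e0.
have [N NP] := archimedean_gt k%:R e e0.
apply: (@le_trans _ _ (vm F r m N.+1 z)).
  by apply: inf_img_le => // n; have /andP[] := vm01 m n z.
apply: le_trans (vm_le_supw m N.+1 k z isT k0) _; rewrite lerD2l.
by rewrite ler_pdivrMr ?ltr0n// (le_trans (ltW NP))// ler_pM2l// ler_nat.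
Qed.

Lemma inf_w_le_inf_vm m z : inf [set w F r m n z | n in [set n | (1 <= n)%N]] <=
  inf [set vm F r m n z | n in [set n | (1 <= n)%N]].
Proof.
apply: le_inf_img => [|n n1]; first by exists 1%N.
apply: le_trans (w_le_vm m n z n1).
by apply: (inf_img_le (fun n => w F r m n z)) => // k; exact: w_ge0.
Qed.

Lemma sup_inf_w_le_sup_inf_vm z : sup_inf_w F r z <= sup_inf_vm F r z.
Proof.
apply: sup_img_le => [|m _]; first by exists 0%N.
apply: le_trans (inf_w_le_inf_vm m z) _.
apply: ub_le_sup; last by exists m.
by exists (vstar F r z) => _ [k _ <-]; exact: inf_vm_le_vstar.
Qed.

Lemma sup_inf_vm_le_vstar z : sup_inf_vm F r z <= vstar F r z.
Proof.
by apply: sup_img_le => [|m _]; [exists 0%N|exact: inf_vm_le_vstar].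
Qed.

(** The stage at which the state of [start_state] is reached is a suitable [m]. *)
Lemma vstar_le_sup_inf_w z : w_finitely_coloured -> vstar F r z <= sup_inf_w F r z.
Proof.
move=> wc; apply/ler_addgt0Pr => e e0; rewrite -lerBlDr.
have [s [m [sz good]]] := start_state z e wc e0.
apply: (@le_trans _ _ (inf [set w F r m n z | n in [set n | (1 <= n)%N]])).
  apply: le_inf_img => [|n n1]; first by exists 1%N.
  exact: le_trans (good n n1) (w_state_le _ _ _ _ sz).
apply: ub_le_sup; last by exists m.
exists (vstar F r z) => _ [k _ <-].
exact: le_trans (inf_w_le_inf_vm k z) (inf_vm_le_vstar k z).
Qed.

End Plays.

(** * Equicontinuity and the theorem *)

(** The colour of a state is the index of a ball containing it, in a finite cover
by balls of radius half the modulus of equicontinuity. *)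
Lemma w_finitely_coloured_of_equicontinuous (R : realType) (Z : metricType R)
    (F : Z -> set Z) (r : Z -> R) : totally_bounded Z ->
  uniformly_equicontinuous
    [set mn : nat * nat | (1 <= mn.2)%N] (fun mn => w F r mn.1 mn.2) ->
  w_finitely_coloured F r.
Proof.
move=> tb ec e e0; have [d d0 dP] := ec _ e0.
have [A /finite_seqP[a ->] cover] := tb (d / 2) (divr_gt0 d0 (ltr0Sn _ _)).
have /choice[c cP] : forall x, exists i : 'I_(size a),
    ball (tnth (in_tuple a) i) (d / 2) x.
  move=> x; have [y /= ya xy] := cover x I; have /tnthP[i yi] : y \in in_tuple a by [].
  by exists i; rewrite -yi.
exists (size a), c => x y cxy m n n0.
have xy : mdist x y < d.
  have : ball x d y by apply: (ball_splitr (cP x)); rewrite cxy; exact: cP.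
  by rewrite ballEmdist.
by have := dP x y xy (m, n) n0 => /=; rewrite ltr_distl => /andP[_ /ltW].
Qed.

Theorem corollary3p8 (R : realType) (Z : metricType R) (F : Z -> set Z) (r : Z -> R)
    (Z_neq0 : [set: Z] !=set0)
    (F_neq0 : forall z, F z !=set0)
    (r01 : forall z, 0 <= r z <= 1)
    (Z_totally_bounded : totally_bounded Z)
    (w_equicontinuous : uniformly_equicontinuous
       [set mn : nat * nat | (1 <= mn.2)%N] (fun mn => w F r mn.1 mn.2)) :
  (forall z : Z,
     is_uniform_value F r z (vstar F r z) /\
     [/\ vstar F r z = vlow F r z,
         vlow F r z = vplus F r z,
         vplus F r z = vminus F r z,
         vminus F r z = sup_inf_vm F r z &
         sup_inf_vm F r z = sup_inf_w F r z]) /\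
  {uniform, (fun n : nat => v F r n) @ \oo --> vstar F r}.
Proof.
have wc := w_finitely_coloured_of_equicontinuous R Z F r
  Z_totally_bounded w_equicontinuous.
split=> [z|].
  have low : vlow F r z = vstar F r z by exact: vlow_vstar.
  have [inf_v sup_v] := cvg_limn_inf_sup (v_cvg F r F_neq0 r01 z wc).
  have plus : vplus F r z = vstar F r z by [].
  have minus : vminus F r z = vstar F r z by [].
  have le1 := vstar_le_sup_inf_w F r F_neq0 r01 z wc.
  have le2 := sup_inf_w_le_sup_inf_vm F r F_neq0 r01 z.
  have le3 := sup_inf_vm_le_vstar F r F_neq0 r01 z.
  have supvm : sup_inf_vm F r z = vstar F r z.
    by apply/le_anti; rewrite le3 (le_trans le1).
  have supw : sup_inf_w F r z = vstar F r z.
    by apply/le_anti; rewrite le1 (le_trans le2).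
  by split; [split|rewrite low plus minus supvm supw].
move=> P /uniform_nbhs[E [entE EP]].
have [e /= e0 eE] : exists2 e : R, 0 < e & forall x y : R, `|x - y| < e -> E (x, y).
  move: entE; rewrite -entourage_ballE => -[e /= e0 eE].
  by exists e => // x y xy; exact: eE.
have [N NP] := v_uniform_cvg F r F_neq0 r01 (e / 2) wc (divr_gt0 e0 (ltr0Sn _ _)).
exists N => // n Nn; apply: EP => z _; apply: eE.
by rewrite distrC (le_lt_trans (NP n z Nn))//; lra.
Qed.
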